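(* Consider two-armed Gaussian batch bandits. Let $c_0>0$ be a constant such that $\inf_{\mathcal A}\sup_{\theta\in\Theta_{\mathbf n}}\mathcal R(\mathcal A,\theta)\ge c_0/\sqrt{\min(n_1,n_2)}$ for all $\mathbf n=(n_1,n_2)$ with $n_1,n_2\ge1$. Fix $\pi_1\in(0,1)$ and, for $n>0$, let $\mathbf n=(n_1,n_2)=(\pi_1n,(1-\pi_1)n)$. Then for any $c>2/c_0$ and any algorithm $\mathcal A$, $$\limsup_{n\to\infty}\ \sup_{\theta\in\Theta_{\mathbf n}}\frac{\mathcal R(\mathcal A,\theta)}{\mathcal R^*_{\mathcal M_{\mathbf n,c}}(\theta)}=+\infty.$$ That is, no algorithm is instance optimal up to a constant multiplicative factor.
   Context: Setting: two arms ($k=2$), counts $\mathbf n=(n_1,n_2)$ (positive, not necessarily integers). An instance $\theta\in\Theta_{\mathbf n}$ is a pair of means $(\mu_1,\mu_2)\in[0,1]^2$; the data are the independent sufficient statistics $X_1\sim\mathcal N(\mu_1,1/n_1)$, $X_2\sim\mathcal N(\mu_2,1/n_2)$ (empirical means of unit-variance Gaussian rewards), together with $\mathbf n$. An algorithm $\mathcal A$ maps $X=(X_1,X_2,\mathbf n)$ to a (possibly randomized) arm $\mathcal A(X)\in\{1,2\}$. Its simple regret is $\mathcal R(\mathcal A,\theta)=\max(\mu_1,\mu_2)-\mathbb E_{X\sim\theta}[\mu_{\mathcal A(X)}]$. For $c\ge1$, the set of minimax optimal algorithms (up to factor $c$) is $\mathcal M_{\mathbf n,c}=\{\mathcal A:\sup_{\theta\in\Theta_{\mathbf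 n}}\mathcal R(\mathcal A,\theta)\le c\cdot\inf_{\mathcal A'}\sup_{\theta\in\Theta_{\mathbf n}}\mathcal R(\mathcal A',\theta)\}$. For a set $\mathcal M$ of algorithms, the instance-dependent lower bound is $\mathcal R^*_{\mathcal M}(\theta)=\inf_{\mathcal A\in\mathcal M}\mathcal R(\mathcal A,\theta)$. Ratios use the conventions $x/0=+\infty$ for $x>0$ and $0/0=0$. *)

(* Defs.v *)
From HB Require Import structures.
From mathcomp Require Import all_boot all_order all_algebra.
From mathcomp Require Import all_classical all_reals all_analysis.

Set Implicit Arguments.
Unset Strict Implicit.
Unset Printing Implicit Defensive.
Import Order.TTheory GRing.Theory Num.Theory.
Import numFieldNormedType.Exports.

Local Open Scope classical_set_scope.
Local Open Scope ring_scope.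

Section batch_bandit.
Context {R : realType}.

(* Counts are pairs of reals (n1, n2); arm 1 is [true] and arm 2 is [false]. *)
Definition observation := (measurableTypeR R * measurableTypeR R)%type.

(* For every count vector, a randomized arm given (X1, X2), i.e. a Markov
   kernel; no regularity in the counts is required. *)
Definition algorithm := R * R -> R.-pker observation ~> bool.

(* Theta_n does not depend on n, which only enters through the data law. *)
Definition instances : set (R * R) :=
  [set theta | 0 <= theta.1 <= 1 /\ 0 <= theta.2 <= 1].

Definition arm_mean (theta : R * R) (a : bool) : R :=
  if a then theta.1 else theta.2.

(* [normal_prob] takes a standard deviation: the variances are 1/n1, 1/n2. *)
Definition data_law (n theta : R * R) : set observation -> \bar R :=
  (normal_prob theta.1 (Num.sqrt n.1^-1) \x
   normal_prob theta.2 (Num.sqrt n.2^-1))%E.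

HB.instance Definition _ n theta := Measure.on (data_law n theta).

Local Open Scope ereal_scope.

Definition regret (n : R * R) (A : algorithm) (theta : R * R) : \bar R :=
  (Num.max theta.1 theta.2)%:E -
  \int[data_law n theta]_x \int[A n x]_a (arm_mean theta a)%:E.

Definition worst_regret (n : R * R) (A : algorithm) : \bar R :=
  ereal_sup [set regret n A theta | theta in instances].

Definition minimax_regret (n : R * R) : \bar R :=
  ereal_inf [set worst_regret n A | A in [set: algorithm]].

Definition minimax_optimal (n : R * R) (c : R) : set algorithm :=
  [set A | worst_regret n A <= c%:E * minimax_regret n].

Definition instance_lower_bound (n : R * R) (M : set algorithm)
    (theta : R * R) : \bar R :=
  ereal_inf [set regret n A theta | A in M].

(* Division in [\bar R] satisfies 0^-1 = +oo and 0 * +oo = 0, hence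
   x / 0 = +oo for x > 0 and 0 / 0 = 0. *)
Definition worst_ratio (n : R * R) (c : R) (A : algorithm) : \bar R :=
  ereal_sup [set regret n A theta /
                 instance_lower_bound n (minimax_optimal n c) theta
            | theta in instances].

End batch_bandit.
Arguments observation : clear implicits.
Arguments algorithm : clear implicits.

(* Main.v *)
(** With N = n1 n2 / (n1 + n2) and r = sqrt N, tilting the two means to a common
    value m turns the law of (X1, X2) under theta into the law under (m, m)
    with weight exp (N (D (X1 - X2) - D^2 / 2)), where D = mu1 - mu2.  Hence
    the rule "play arm 1 iff b <= X1 - X2" has regret at most
    |D| exp (N (D b - D^2 / 2)); for |b| = 1 / (2 r) this is at most
    sqrt 2 / r <= 2 / sqrt (min n1 n2), so both shifts b = 1 / (2 r) and
    b = - 1 / (2 r) are minimax optimal up to any factor c > 2 / c0.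

    Take two instances with D = 1/2 and D = -1/2 and the same m = 1/2.  On the
    window |X_i - 1/2| <= 1 / (8 sqrt n_i), whose mass does not depend on n,
    both weights are at least exp (- r / 8 - r^2 / 8), so every algorithm errs
    with at least a constant times this probability on one of the two
    instances.  The rule shifted in favour of the right arm errs with
    probability at most exp (- r / 4 - r^2 / 8) there, and the ratio grows like
    exp (r / 8). *)
Require Import Defs.
From mathcomp Require Import all_boot all_order all_algebra.
From mathcomp Require Import all_classical all_reals all_analysis.
From mathcomp Require Import measurable_realfun ring lra.
Set Implicit Arguments.
Unset Strict Implicit.
Unset Printing Implicit Defensive.
Import Order.TTheory GRing.Theory Num.Theory.
Import numFieldNormedType.Exports.
Local Open Scope classical_set_scope.
Local Open Scope ring_scope.

(** * Integration against a measure that has a density *)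

Section density.
Local Open Scope ereal_scope.
Context d (T : measurableType d) (R : realType).
Variables (mu nu : {measure set T -> \bar R}) (h : T -> R).
Hypothesis mh : measurable_fun [set: T] h.
Hypothesis h0 : forall x, (0 <= h x)%R.
Hypothesis nuE : forall B, measurable B -> nu B = \int[mu]_(x in B) (h x)%:E.

Import HBNNSimple.

Let integral_density_nnsfun (f : {nnsfun T >-> R}) :
  \int[nu]_x (f x)%:E = \int[mu]_x ((f x)%:E * (h x)%:E).
Proof.
under eq_integral do rewrite fimfunE -fsumEFin//.
rewrite ge0_integral_fsum//; last 2 first.
  - by move=> r; exact/measurable_EFinP/measurableT_comp.
  - by move=> n x _; rewrite EFinM nnfun_muleindic_ge0.
under [RHS]eq_integral.
  move=> x _; rewrite fimfunE -fsumEFin// muleC ge0_mule_fsumr; last first.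
    by move=> r; rewrite EFinM nnfun_muleindic_ge0.
  over.
rewrite [RHS]ge0_integral_fsum//; last 2 first.
  - move=> r; apply: emeasurable_funM; first exact/measurable_EFinP.
    by apply/measurable_EFinP; do 2 apply/measurableT_comp => //.
  - move=> n x _; apply: mule_ge0; first by rewrite lee_fin.
    by rewrite EFinM nnfun_muleindic_ge0.
apply: eq_fsbigr => r _; rewrite integralZl_indic_nnsfun//= integral_indic//.
rewrite setIT nuE// integral_mkcond.
(* Pulling the constant [r] out of the integral needs [0 <= r]; a negative [r] has empty preimage
   under the nonnegative [f], so both sides vanish. *)
have [r0|r0] := ltP r 0%R.
  rewrite preimage_nnfun0// -integral_mkcond integral_set0 mule0 integral0_eq//.
  move=> x _.
  by rewrite indic0 mulr0 mule0.
rewrite -ge0_integralZl//.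
- apply: eq_integral => x _; rewrite patchE indicE.
  by case: ifPn => _ /=; rewrite ?mulr1 ?mulr0 ?mule0// muleC.
- apply/(measurable_restrictT _ _).1 => //.
  by apply/measurable_EFinP; exact: measurable_funTS.
- by move=> x _; rewrite patchE; case: ifPn; rewrite ?lee_fin.
Qed.

(** Monotone convergence along simple approximations reduces this to simple functions, where
    linearity leaves only indicators, that is, [nuE]. *)
Lemma ge0_integral_density (f : T -> \bar R) :
  measurable_fun [set: T] f -> (forall x, 0 <= f x) ->
  \int[nu]_x f x = \int[mu]_x (f x * (h x)%:E).
Proof.
move=> mf f0; pose f_ := nnsfun_approx measurableT mf.
have f_cvg x : (f_ n x)%:E @[n --> \oo] --> f x by exact: cvg_nnsfun_approx.
transitivity (lim (\int[nu]_x (f_ n x)%:E @[n --> \oo])).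
  rewrite -monotone_convergence//=.
  - by apply: eq_integral => x _; apply/esym/cvg_lim => //; exact: f_cvg.
  - by move=> n; exact/measurable_EFinP.
  - by move=> n x _; rewrite lee_fin.
  - by move=> x _ p q pq; rewrite lee_fin; exact/lefP/nd_nnsfun_approx.
transitivity (lim (\int[mu]_x ((f_ n x)%:E * (h x)%:E) @[n --> \oo])).
  by apply: congr_lim; apply/funext => n /=; exact: integral_density_nnsfun.
rewrite -monotone_convergence//=.
- apply: eq_integral => x _; apply: cvg_lim => //.
  by apply: cvgeZr => //; exact: f_cvg.
- by move=> n; apply: emeasurable_funM; exact/measurable_EFinP.
- by move=> n x _; rewrite mule_ge0 ?lee_fin.
- move=> x _ p q pq; rewrite lee_wpmul2r ?lee_fin//.
  exact/lefP/nd_nnsfun_approx.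
Qed.

End density.

(** * Exponential tilting of a one-dimensional Gaussian *)

Section normal.
Context {R : realType}.
Implicit Types (m a s : R).

(** Gaussian likelihood ratio: the quadratic terms in [x] cancel because the variances agree, and an
    exponential of a linear function of [x] remains. *)
Lemma normal_pdf_shift m a s x : s != 0 ->
  normal_pdf (m + a) s x =
  normal_pdf m s x * expR ((a * (x - m) - a ^+ 2 / 2) / s ^+ 2).
Proof.
move=> s0; rewrite !normal_pdfE// -mulrA; congr (_ * _).
rewrite /normal_fun -expRD; congr expR; field.
by rewrite s0.
Qed.

Lemma measurable_normal_weight m a s : measurable_fun [set: measurableTypeR R]
  (fun x => (expR ((a * (x - m) - a ^+ 2 / 2) / s ^+ 2))%:E).
Proof.
apply/measurable_EFinP; apply: measurableT_comp => //.
apply: measurable_funM => //; apply: measurable_funB => //.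
by apply: measurable_funM => //; exact: measurable_funB.
Qed.

Lemma ge0_integral_normal m s (f : measurableTypeR R -> \bar R) :
  measurable_fun [set: measurableTypeR R] f -> (forall x, 0 <= f x)%E ->
  (\int[normal_prob m s]_x f x =
   \int[lebesgue_measure]_x (f x * (normal_pdf m s x)%:E))%E.
Proof.
move=> mf f0; apply: ge0_integral_density => //.
- exact: measurable_normal_pdf.
- exact: normal_pdf_ge0.
Qed.

Lemma ge0_integral_normal_shift m a s (f : measurableTypeR R -> \bar R) :
  s != 0 ->
  measurable_fun [set: measurableTypeR R] f -> (forall x, 0 <= f x)%E ->
  (\int[normal_prob (m + a) s]_x f x =
   \int[normal_prob m s]_x
     (f x * (expR ((a * (x - m) - a ^+ 2 / 2) / s ^+ 2))%:E))%E.
Proof.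
move=> s0 mf f0; rewrite !ge0_integral_normal//.
- apply: eq_integral => x _.
  by rewrite normal_pdf_shift// mulrC EFinM muleA.
- exact: emeasurable_funM mf (measurable_normal_weight m a s).
- by move=> x; rewrite mule_ge0 ?lee_fin ?expR_ge0.
Qed.

End normal.

(** * Mass of an interval of a fixed number of standard deviations *)

Section normal_interval.
Context {R : realType}.
Implicit Types (m s a : R).

(** The density on the interval is at least its value at the endpoints. The length [2 * a * s]
    cancels the factor [1 / s] of the peak, so the bound does not depend on [s], hence later not on
    the counts. *)
Lemma normal_prob_itv_ge m s a : 0 < s -> 0 < a ->
  ((2 * a / Num.sqrt (pi *+ 2) * expR (- a ^+ 2 / 2))%:E <=
   normal_prob m s `[(m - a * s)%R, (m + a * s)%R]%classic)%E.
Proof.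
move=> s0 a0; have sn0 : s != 0 by rewrite gt_eqF.
pose I := `[m - a * s, m + a * s]%classic.
have mI : measurable I by exact: measurable_itv.
rewrite -/I.
apply: (@le_trans _ _ (\int[lebesgue_measure]_(x in I)
   (normal_peak s * expR (- a ^+ 2 / 2))%:E)%E).
  rewrite integral_cst//= /I lebesgue_measure_itv/= lte_fin ifT; last first.
    by have := mulr_gt0 a0 s0; lra.
  rewrite -EFinD -EFinM lee_fin /normal_peak -mulrnAr sqrtrM ?sqr_ge0//.
  rewrite sqrtr_sqr gtr0_norm// le_eqVlt; apply/orP; left; apply/eqP.
  have q0 : Num.sqrt (pi *+ 2) != 0 :> R.
    by rewrite gt_eqF// sqrtr_gt0 mulrn_wgt0// pi_gt0.
  field; exact/andP.
rewrite /normal_prob; apply: ge0_le_integral => //=.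
- by move=> x _; rewrite lee_fin mulr_ge0 ?expR_ge0// normal_peak_ge0.
- apply/measurable_EFinP; apply: measurable_funTS.
  exact: measurable_normal_pdf.
- move=> x; rewrite /I/= in_itv/= => /andP[x1 x2].
  rewrite lee_fin normal_pdfE// ler_wpM2l ?normal_peak_ge0//.
  rewrite /normal_fun ler_expR !mulNr lerN2 -mulr_natr.
  rewrite ler_pdivrMr ?mulr_gt0 ?exprn_gt0//.
  have -> : a ^+ 2 / 2 * (s ^+ 2 * 2) = (a * s) ^+ 2 by field.
  by rewrite -ler_sqrt ?sqr_ge0// !sqrtr_sqr (@gtr0_norm _ (a * s)) ?mulr_gt0//
    ler_norml; apply/andP; split; lra.
Qed.

End normal_interval.

(** * Change of measure for the pair of empirical means *)

Section data_law.
Context {R : realType}.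
Implicit Types (n theta : R * R) (m : R).
Local Open Scope ereal_scope.

Lemma data_law_setT n theta : data_law n theta [set: observation R] = 1.
Proof.
rewrite /data_law -setXTT product_measure1E//.
have H m s : normal_prob m s [set: measurableTypeR R] = 1.
  exact: (probability_setT (normal_prob m s)).
by transitivity (1 * 1 : \bar R); [congr (_ * _); exact: H|rewrite mule1].
Qed.

Lemma measurable_tilt n (D : R) : measurable_fun [set: observation R]
  (fun x => (expR (n.1 * n.2 / (n.1 + n.2) * (D * (x.1 - x.2) - D ^+ 2 / 2)))%:E).
Proof.
apply/measurable_EFinP; apply: measurableT_comp => //.
apply: measurable_funM => //; apply: measurable_funB => //.
by apply: measurable_funM => //; exact: measurable_funB.
Qed.

Lemma ge0_integral_data_lawE n theta (g : observation R -> \bar R) :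
  measurable_fun [set: observation R] g -> (forall x, 0 <= g x) ->
  \int[data_law n theta]_x g x =
  \int[normal_prob theta.1 (Num.sqrt n.1^-1)]_x
    \int[normal_prob theta.2 (Num.sqrt n.2^-1)]_y g (x, y).
Proof.
move=> mg g0.
exact: (@fubini_tonelli1 _ _ _ _ _ (normal_prob theta.1 (Num.sqrt n.1^-1))
  (normal_prob theta.2 (Num.sqrt n.2^-1)) g mg g0).
Qed.

(** By Tonelli, the one-dimensional tilt applies to the second coordinate and then to the first. The
    target [m] is the average of the two means weighted by the counts; this choice makes the weight
    depend on the data through [x.1 - x.2] only. *)
Lemma ge0_integral_data_law n theta m (g : observation R -> \bar R) :
  (0 < n.1)%R -> (0 < n.2)%R ->
  (m * (n.1 + n.2) = n.1 * theta.1 + n.2 * theta.2)%R ->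
  measurable_fun [set: observation R] g -> (forall x, 0 <= g x) ->
  \int[data_law n theta]_x g x =
  \int[data_law n (m, m)]_x
    (g x * (expR (n.1 * n.2 / (n.1 + n.2) *
      ((theta.1 - theta.2) * (x.1 - x.2) - (theta.1 - theta.2) ^+ 2 / 2)))%:E).
Proof.
move=> n1 n2 mE mg g0; set D := (theta.1 - theta.2)%R.
have n12 : (n.1 + n.2 != 0)%R by rewrite gt_eqF// addr_gt0.
(* [a1] and [a2] are the displacements of the two means from [m]. Since
   [n.1 * a1 = - (n.2 * a2) = N * D], the terms in [m] cancel in the product of the weights, and the
   squares add up to [N * D ^+ 2]. *)
set a1 := (D * n.2 / (n.1 + n.2))%R.
set a2 := (- (D * n.1 / (n.1 + n.2)))%R.
have {mE}mE : (m = (n.1 * theta.1 + n.2 * theta.2) / (n.1 + n.2))%R.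
  by rewrite -mE mulfK.
have t1 : theta.1 = (m + a1)%R by rewrite mE /a1 /D; field.
have t2 : theta.2 = (m + a2)%R by rewrite mE /a2 /D; field.
pose s1 := Num.sqrt n.1^-1; pose s2 := Num.sqrt n.2^-1.
have s10 : (s1 != 0)%R by rewrite gt_eqF// sqrtr_gt0 invr_gt0.
have s20 : (s2 != 0)%R by rewrite gt_eqF// sqrtr_gt0 invr_gt0.
have s1E : (s1 ^+ 2 = n.1^-1)%R by rewrite sqr_sqrtr// invr_ge0 ltW.
have s2E : (s2 ^+ 2 = n.2^-1)%R by rewrite sqr_sqrtr// invr_ge0 ltW.
pose w1 x := expR ((a1 * (x - m) - a1 ^+ 2 / 2) / s1 ^+ 2).
pose w2 x := expR ((a2 * (x - m) - a2 ^+ 2 / 2) / s2 ^+ 2).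
have mw2 : measurable_fun [set: measurableTypeR R] (fun x => (w2 x)%:E).
  exact: measurable_normal_weight.
have mgx x : measurable_fun [set: measurableTypeR R] (fun y => g (x, y)).
  by apply: measurableT_comp => //; exact: pair1_measurable.
have mgw : measurable_fun [set: observation R] (fun z => g z * (w2 z.2)%:E).
  apply: emeasurable_funM => //.
  exact: (measurableT_comp mw2 measurable_snd).
rewrite [LHS](ge0_integral_data_lawE n theta mg g0) t1 t2.
have g20 z : 0 <= g z * (w2 z.2)%:E by rewrite mule_ge0// lee_fin expR_ge0.
pose G x := \int[normal_prob m s2]_y (g (x, y) * (w2 y)%:E).
have mG : measurable_fun [set: measurableTypeR R] G.
  exact: (measurable_fun_fubini_tonelli_F (m2 := normal_prob m s2)
    _ mgw g20).
have G0 x : 0 <= G x by apply: integral_ge0 => y _; exact: (g20 (x, y)).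
transitivity (\int[normal_prob (m + a1) s1]_x G x).
  apply: eq_integral => x _.
  by rewrite (ge0_integral_normal_shift m a2 s20 (mgx x) (fun y => g0 (x, y))).
rewrite [LHS](ge0_integral_normal_shift m a1 s10 mG G0).
rewrite [RHS]ge0_integral_data_lawE.
- apply: eq_integral => x _.
  rewrite /G -(@ge0_integralZr _ _ _ (normal_prob m s2)).
  + apply: eq_integral => y _; rewrite -muleA -EFinM -expRD.
    congr (_ * (expR _)%:E).
    rewrite /w1 /w2 s1E s2E !invrK /a1 /a2 /=; field.
    exact: n12.
  + exact: measurableT.
  + exact: emeasurable_funM (mgx x) mw2.
  + by move=> y _; exact: (g20 (x, y)).
  + by rewrite lee_fin expR_ge0.
- exact: emeasurable_funM mg (measurable_tilt n D).
- by move=> z; rewrite mule_ge0// lee_fin expR_ge0.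
Qed.

(** A Chernoff-type bound: the weight is at most the stated constant on [B], and the reference law
    with equal means has total mass 1. *)
Lemma data_law_le n theta (b : R) (B : set (observation R)) :
  (0 < n.1)%R -> (0 < n.2)%R -> measurable B ->
  (forall x, B x -> (theta.1 - theta.2) * (x.1 - x.2) <= b)%R ->
  data_law n theta B <=
    (expR (n.1 * n.2 / (n.1 + n.2) * (b - (theta.1 - theta.2) ^+ 2 / 2)))%:E.
Proof.
set D := (theta.1 - theta.2)%R => n1 n2 mB Bb.
set m := ((n.1 * theta.1 + n.2 * theta.2) / (n.1 + n.2))%R.
have N0 : (0 <= n.1 * n.2 / (n.1 + n.2))%R.
  by rewrite divr_ge0 ?mulr_ge0 ?addr_ge0 ?ltW.
have mi : measurable_fun [set: observation R] (fun x => (\1_B x : R)%:E).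
  by apply/measurable_EFinP; exact: measurable_indic.
rewrite -(setIT B) -integral_indic// (@ge0_integral_data_law _ _ m)//; last first.
  by rewrite /m divfK// gt_eqF// addr_gt0.
rewrite -/D; set c := (X in _ <= X%:E).
apply: (@le_trans _ _ (\int[data_law n (m, m)]_x (cst c%:E x))).
  apply: ge0_le_integral => //=.
  - exact: emeasurable_funM mi (measurable_tilt n D).
  - move=> x _; rewrite indicE; case: (boolP (x \in B)) => [|_]; last first.
      by rewrite mul0e lee_fin expR_ge0.
    rewrite inE => /Bb xb; rewrite mul1e lee_fin ler_expR ler_wpM2l//.
    exact: lerB.
by rewrite integral_cst// [X in _ * X](data_law_setT n (m, m)) mule1.
Qed.

(** The converse estimate: discard everything outside [W], where the weight is at least the stated
    constant. The remaining integral involves [theta] only through [m], so two instances with the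
    same [m] can be compared. *)
Lemma data_law_ge n theta m (b : R) (f : observation R -> \bar R)
    (W : set (observation R)) :
  (0 < n.1)%R -> (0 < n.2)%R ->
  (m * (n.1 + n.2) = n.1 * theta.1 + n.2 * theta.2)%R ->
  measurable_fun [set: observation R] f -> (forall x, 0 <= f x) ->
  measurable W ->
  (forall x, W x -> b <= (theta.1 - theta.2) * (x.1 - x.2))%R ->
  (expR (n.1 * n.2 / (n.1 + n.2) * (b - (theta.1 - theta.2) ^+ 2 / 2)))%:E *
    \int[data_law n (m, m)]_(x in W) f x
  <= \int[data_law n theta]_x f x.
Proof.
set D := (theta.1 - theta.2)%R => n1 n2 mE mf f0 mW Wb.
have N0 : (0 <= n.1 * n.2 / (n.1 + n.2))%R.
  by rewrite divr_ge0 ?mulr_ge0 ?addr_ge0 ?ltW.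
rewrite [leRHS](ge0_integral_data_law n1 n2 mE mf f0) -/D.
have mg : measurable_fun [set: observation R] (fun x => f x *
    (expR (n.1 * n.2 / (n.1 + n.2) * (D * (x.1 - x.2) - D ^+ 2 / 2)))%:E).
  by apply: emeasurable_funM => //; exact: measurable_tilt.
apply: (@le_trans _ _ (\int[data_law n (m, m)]_(x in W) (f x *
    (expR (n.1 * n.2 / (n.1 + n.2) * (D * (x.1 - x.2) - D ^+ 2 / 2)))%:E))).
  have mfW : measurable_fun W f by exact: measurable_funTS.
  rewrite -(ge0_integralZl (data_law n (m, m)) mW mfW (fun x _ => f0 x)); last first.
    by rewrite lee_fin expR_ge0.
  apply: (ge0_le_integral (data_law n (m, m)) mW).
  - by move=> x _; rewrite mule_ge0// lee_fin expR_ge0.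
  - exact: measurable_funeM.
  - exact: measurable_funTS.
  - move=> x Wx; rewrite muleC lee_wpmul2l// lee_fin ler_expR ler_wpM2l//.
    by apply: lerB => //; exact: Wb.
apply: ge0_subset_integral => //.
by move=> x _; rewrite mule_ge0 ?lee_fin ?expR_ge0.
Qed.

End data_law.

(** * Regret as gap times error probability, and threshold rules *)

Section regret.
Context {R : realType}.
Implicit Types (n theta : R * R) (A : algorithm R).
Local Open Scope ereal_scope.

(** Stated as a sum rather than a difference, so that it can be integrated over the data by
    additivity for nonnegative functions. *)
Lemma integral_arm_mean (P : {measure set bool -> \bar R}) theta (b : bool) :
  P [set: bool] = 1 ->
  (0 <= theta.1)%R -> (0 <= theta.2)%R ->
  (arm_mean theta b <= arm_mean theta (~~ b))%R ->
  \int[P]_a (arm_mean theta a)%:E +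
    (arm_mean theta (~~ b) - arm_mean theta b)%:E * P [set b] =
  (arm_mean theta (~~ b))%:E.
Proof.
move=> P1 t1 t2 tb.
have d0 : (0 <= arm_mean theta (~~ b) - arm_mean theta b)%R by rewrite subr_ge0.
have mb (f : bool -> \bar R) : measurable_fun [set: bool] f.
  by move=> _ Y mY.
rewrite -(setIT [set b]) -integral_indic// -ge0_integralZl//.
rewrite -ge0_integralD//; last 2 first.
- by move=> [] _; rewrite lee_fin.
- by move=> x _; rewrite -EFinM lee_fin mulr_ge0.
rewrite (eq_integral (cst (arm_mean theta (~~ b))%:E)); last first.
  move=> a _; rewrite indicE -EFinM -EFinD/=; congr EFin.
  case: (boolP (a \in _)); first by rewrite inE => ->; rewrite mulr1 subrKC.
  rewrite notin_setE mulr0 addr0 => nab; congr arm_mean.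
  by move: nab; clear; case: a; case: b => // nab; case: nab.
by rewrite integral_cst// [X in _ * X]P1 mule1.
Qed.

Lemma measurable_algorithm A n (b : bool) :
  measurable_fun [set: observation R] (fun x => A n x [set b]).
Proof. exact: measurable_kernel. Qed.

Definition arm_prob n A theta (b : bool) : \bar R :=
  \int[data_law n theta]_x A n x [set b].

Lemma arm_prob_ge0 n A theta b : 0 <= arm_prob n A theta b.
Proof. exact: integral_ge0. Qed.

(** Here [b] is the worse arm, ties allowed: choosing it costs the gap and choosing the other arm
    costs nothing. *)
Lemma regretE n A theta (b : bool) :
  (0 <= theta.1)%R -> (0 <= theta.2)%R ->
  (arm_mean theta b <= arm_mean theta (~~ b))%R ->
  regret n A theta = (arm_mean theta (~~ b) - arm_mean theta b)%:E *
    arm_prob n A theta b.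
Proof.
move=> t1 t2 tb.
have d0 : (0 <= arm_mean theta (~~ b) - arm_mean theta b)%R by rewrite subr_ge0.
have mI : measurable_fun [set: observation R]
    (fun x => \int[A n x]_a (arm_mean theta a)%:E).
  apply: measurable_fun_integral_kernel => //.
  - by move=> U mU; exact: measurable_kernel.
  - by move=> a; rewrite lee_fin; case: a.
have I0 x : 0 <= \int[A n x]_a (arm_mean theta a)%:E.
  by apply: integral_ge0 => -[] _; rewrite lee_fin.
rewrite /regret; set I := \int[_]_x _; set J := arm_prob _ _ _ _.
have J0 : 0 <= J by exact: arm_prob_ge0.
have IJ : I + (arm_mean theta (~~ b) - arm_mean theta b)%:E * J =
    (arm_mean theta (~~ b))%:E.
  rewrite /J /arm_prob -ge0_integralZl//; last exact: measurable_algorithm.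
  rewrite -ge0_integralD//; last 2 first.
  - by move=> x _; rewrite mule_ge0 ?lee_fin.
  - by apply: measurable_funeM; exact: measurable_algorithm.
  rewrite (eq_integral (cst (arm_mean theta (~~ b))%:E)); last first.
    move=> x _; apply: (integral_arm_mean (P := A n x)) => //.
    exact: prob_kernel.
  by rewrite integral_cst// [X in _ * X](data_law_setT n theta) mule1.
have -> : Num.max theta.1 theta.2 = arm_mean theta (~~ b).
  by case: b tb {J J0 IJ d0} => /= tb; [rewrite max_r|rewrite max_l].
(* Cancelling [I] in the extended reals requires it to be finite; it is, being at most the best
   mean. *)
rewrite -IJ addeAC subee ?add0e//.
have : I <= (arm_mean theta (~~ b))%:E.
  by rewrite -IJ leeDl// mule_ge0 ?lee_fin.
rewrite ge0_fin_numE; last exact: integral_ge0.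
by move=> /le_lt_trans; apply; rewrite ltry.
Qed.

Lemma regret_ge0 n A theta : instances theta -> 0 <= regret n A theta.
Proof.
move=> [/andP[t10 _] /andP[t20 _]].
have [t12|/ltW t12] := leP theta.1 theta.2.
- rewrite (@regretE _ _ _ true)//= mule_ge0//; first by rewrite lee_fin subr_ge0.
  exact: arm_prob_ge0.
- rewrite (@regretE _ _ _ false)//= mule_ge0//; first by rewrite lee_fin subr_ge0.
  exact: arm_prob_ge0.
Qed.

Lemma measurable_threshold (b : R) : measurable_fun [set: observation R]
  (fun x : observation R => (b <= x.1 - x.2)%R).
Proof. by apply: measurable_fun_ler => //; exact: measurable_funB. Qed.

(** The rule ignores the counts: [b] is chosen for one fixed [n], and membership in
    [minimax_optimal n c] only concerns the behaviour at that [n]. *)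
Definition threshold (b : R) : algorithm R :=
  fun=> (kdirac (measurable_threshold b) :
         R.-pker observation R ~> bool).

(** Whichever arm is better, on the error event [(theta.1 - theta.2) * (x.1 - x.2)] is at most
    [(theta.1 - theta.2) * b], so [data_law_le] bounds both cases by the same expression. *)
Lemma regret_threshold_le n theta (b : R) :
  (0 < n.1)%R -> (0 < n.2)%R -> instances theta ->
  regret n (threshold b) theta <=
    (`|theta.1 - theta.2| * expR (n.1 * n.2 / (n.1 + n.2) *
       ((theta.1 - theta.2) * b - (theta.1 - theta.2) ^+ 2 / 2)))%:E.
Proof.
move=> n1 n2 [/andP[t10 _] /andP[t20 _]].
set D := (theta.1 - theta.2)%R.
pose B a := [set x : observation R | (b <= x.1 - x.2)%R = a].
have mB a : measurable (B a).
  by rewrite -[B a]setTI; exact: (@measurable_threshold b measurableT [set a]).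
have PB a : arm_prob n (threshold b) theta a = data_law n theta (B a).
  rewrite /arm_prob.
  have <- : \int[data_law n theta]_x (\1_(B a) x)%:E = data_law n theta (B a).
    rewrite integral_indic; [|exact: measurableT|exact: mB].
    exact: (congr1 (data_law n theta) (setIT (B a))).
  by apply: eq_integral => x _; rewrite /threshold/kdirac/= diracE indicE.
have [t12|t12] := leP theta.1 theta.2.
- rewrite (@regretE n _ _ true t10 t20 t12) PB EFinM/=.
  rewrite (_ : `|D|%R = theta.2 - theta.1)%R; last first.
    by rewrite ler0_norm ?opprB// subr_le0.
  apply: lee_wpmul2l; first by rewrite lee_fin subr_ge0.
  apply: data_law_le => // x bx; rewrite ler_wnM2l ?subr_le0//.
- rewrite (@regretE n _ _ false t10 t20 (ltW t12)) PB EFinM/=.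
  rewrite (_ : `|D|%R = theta.1 - theta.2)%R; last first.
    by rewrite gtr0_norm// subr_gt0.
  apply: lee_wpmul2l; first by rewrite lee_fin subr_ge0 ltW.
  apply: data_law_le => // x /negbT; rewrite -ltNge => bx.
  by rewrite ler_wpM2l ?subr_ge0// ltW.
Qed.

End regret.

(** * A data window whose mass is bounded below uniformly in the counts *)

Section window.
Context {R : realType}.
Implicit Types (n theta : R * R).
Local Open Scope ereal_scope.

Definition window n (m a : R) : set (observation R) :=
  `[(m - a * Num.sqrt n.1^-1)%R, (m + a * Num.sqrt n.1^-1)%R]%classic `*`
  `[(m - a * Num.sqrt n.2^-1)%R, (m + a * Num.sqrt n.2^-1)%R]%classic.

Lemma measurable_window n m a : measurable (window n m a).
Proof. by apply: measurableX; exact: measurable_itv. Qed.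

(** The bound of [normal_prob_itv_ge], squared for the two independent coordinates: a lower bound
    for the mass of the window, not its exact value. *)
Definition window_mass (a : R) : R :=
  (2 * a / Num.sqrt (pi *+ 2) * expR (- a ^+ 2 / 2)) ^+ 2.

Lemma window_mass_gt0 a : (0 < a)%R -> (0 < window_mass a)%R.
Proof.
move=> a0; rewrite exprn_gt0// mulr_gt0 ?expR_gt0// divr_gt0 ?mulr_gt0//.
by rewrite sqrtr_gt0 mulrn_wgt0// pi_gt0.
Qed.

Lemma data_law_window n m a : (0 < n.1)%R -> (0 < n.2)%R -> (0 < a)%R ->
  (window_mass a)%:E <= data_law n (m, m) (window n m a).
Proof.
move=> n1 n2 a0.
have s0 k : (0 < k)%R -> (0 < Num.sqrt (k^-1 : R))%R.
  by move=> k0; rewrite sqrtr_gt0 invr_gt0.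
rewrite /data_law /window product_measure1E; [|exact: measurable_itv..].
rewrite /window_mass expr2 EFinM; apply: lee_pmul.
- by rewrite lee_fin mulr_ge0 ?expR_ge0// divr_ge0 ?sqrtr_ge0 ?mulr_ge0 ?ltW.
- by rewrite lee_fin mulr_ge0 ?expR_ge0// divr_ge0 ?sqrtr_ge0 ?mulr_ge0 ?ltW.
- exact: normal_prob_itv_ge (s0 _ n1) a0.
- exact: normal_prob_itv_ge (s0 _ n2) a0.
Qed.

Lemma window_diff n m a (x : observation R) :
  (0 < n.1)%R -> (0 < n.2)%R -> (0 < a)%R -> window n m a x ->
  (`|x.1 - x.2| <= 2 * a / Num.sqrt (n.1 * n.2 / (n.1 + n.2)))%R.
Proof.
move=> n1 n2 a0 [/=]; rewrite !in_itv/= => /andP[l1 u1] /andP[l2 u2].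
set r := Num.sqrt (_ / _)%R.
have n120 : (0 < n.1 + n.2)%R by exact: addr_gt0.
have sr (k : R) : (k^-1 <= (n.1 * n.2 / (n.1 + n.2))^-1)%R ->
    (Num.sqrt k^-1 <= r^-1)%R.
  by move=> kN; rewrite /r -sqrtrV ?ler_wsqrtr// divr_ge0 ?mulr_ge0 ?ltW.
(* The variance of [x.1 - x.2] is the sum of the two variances, so each standard deviation is at
   most [r^-1]. *)
have E : ((n.1 * n.2 / (n.1 + n.2))^-1 = n.1^-1 + n.2^-1)%R.
  by field; rewrite !gt_eqF.
have s1 : (Num.sqrt n.1^-1 <= r^-1)%R.
  by apply: sr; rewrite E lerDl invr_ge0 ltW.
have s2 : (Num.sqrt n.2^-1 <= r^-1)%R.
  by apply: sr; rewrite E lerDr invr_ge0 ltW.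
have {}s1 : (a * Num.sqrt n.1^-1 <= a * r^-1)%R by rewrite ler_pM2l.
have {}s2 : (a * Num.sqrt n.2^-1 <= a * r^-1)%R by rewrite ler_pM2l.
rewrite -mulrA; move: s1 s2 l1 l2 u1 u2.
set p := (a * r^-1)%R; set s := (a * _)%R; set t := (a * _)%R => *.
by rewrite ler_norml; apply/andP; split; lra.
Qed.

End window.

(** * Minimax optimality of the shifted threshold rules *)

Section minimax.
Context {R : realType}.
Implicit Types (n theta : R * R).

(** With [y = t ^+ 2 / 2 - t / 2], the inequality [1 + y <= expR y] reduces the claim to a quadratic
    in [t] without real roots. *)
Lemma mul_expR_quadratic_le (t : R) : 0 <= t ->
  t * expR (t / 2 - t ^+ 2 / 2) <= Num.sqrt 2.
Proof.
move=> t0; set w := Num.sqrt 2.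
have w2 : w * w = 2 by rewrite -expr2 sqr_sqrtr.
have w0 : 0 <= w by exact: sqrtr_ge0.
have wl : 7 / 5 <= w by nra.
have wu : w <= 3 / 2 by nra.
pose y := t ^+ 2 / 2 - t / 2.
have y1 : 0 < 1 + y by rewrite /y; nra.
have ey : 1 + y <= expR y by exact: expR_ge1Dx.
have -> : t / 2 - t ^+ 2 / 2 = - y by rewrite /y; ring.
rewrite expRN ler_pdivrMr ?expR_gt0//.
apply: (@le_trans _ _ (w * (1 + y))); last by rewrite ler_wpM2l.
rewrite /y.
(* Replacing [w] by its rational bounds leaves 7/10 times [t ^+ 2 - 5 / 2 * t + 2], which is
   positive with vertex at 5/4. *)
have h1 : 0 <= (w - 7 / 5) * t ^+ 2 by rewrite mulr_ge0 ?subr_ge0 ?sqr_ge0.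
have h2 : 0 <= (3 / 2 - w) * t by rewrite mulr_ge0 ?subr_ge0.
have h3 : 0 <= (t - 5 / 4) ^+ 2 by exact: sqr_ge0.
nra.
Qed.

(** As [D * b <= |D| * |b|], the sign of [b] does not matter, and the substitution [t = |D| * r]
    turns the regret bound into the one-variable inequality above. *)
Lemma worst_regret_threshold_le n (b : R) :
  let r := Num.sqrt (n.1 * n.2 / (n.1 + n.2)) in
  0 < n.1 -> 0 < n.2 -> `|b| = (2 * r)^-1 ->
  (worst_regret n (threshold b) <= (Num.sqrt 2 / r)%:E)%E.
Proof.
move=> r n1 n2 bE.
have N0 : 0 < n.1 * n.2 / (n.1 + n.2) by rewrite divr_gt0 ?mulr_gt0 ?addr_gt0.
have r0 : 0 < r by rewrite sqrtr_gt0.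
have Nr : n.1 * n.2 / (n.1 + n.2) = r ^+ 2 by rewrite sqr_sqrtr// ltW.
apply: ge_ereal_sup => _ [theta theta01 <-].
apply: (le_trans (regret_threshold_le b n1 n2 theta01)).
rewrite Nr; set D := theta.1 - theta.2.
rewrite lee_fin ler_pdivlMr// mulrAC.
pose t := `|D| * r.
have t0 : 0 <= t by rewrite mulr_ge0 ?normr_ge0// ltW.
apply: le_trans (mul_expR_quadratic_le t0).
rewrite ler_wpM2l// ler_expR.
have -> : t / 2 - t ^+ 2 / 2 = r ^+ 2 * (`|D| * (2 * r)^-1 - D ^+ 2 / 2).
  rewrite /t exprMn real_normK ?num_real//; field.
  by rewrite gt_eqF.
rewrite ler_wpM2l ?sqr_ge0// lerD2r -bE -normrM; exact: ler_norm.
Qed.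

Lemma threshold_minimax_optimal n (c0 c b : R) :
  let r := Num.sqrt (n.1 * n.2 / (n.1 + n.2)) in
  0 < n.1 -> 0 < n.2 -> 0 < c0 -> 2 / c0 < c ->
  ((c0 / Num.sqrt (Num.min n.1 n.2))%:E <= minimax_regret n)%E ->
  `|b| = (2 * r)^-1 -> minimax_optimal n c (threshold b).
Proof.
move=> r n1 n2 c00 c_gt lb bE; rewrite /minimax_optimal/=.
have c_gt0 : 0 < c by rewrite (lt_trans _ c_gt)// divr_gt0.
have N0 : 0 < n.1 * n.2 / (n.1 + n.2) by rewrite divr_gt0 ?mulr_gt0 ?addr_gt0.
have r0 : 0 < r by rewrite sqrtr_gt0.
have nmin0 : 0 < Num.min n.1 n.2 by rewrite lt_min n1.
(* The sum of the counts is at most twice the larger one, so the minimum is at most 2N. This gives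
   [sqrt 2 / r <= 2 / sqrt (min n.1 n.2)], whence the threshold [2 / c0] for [c]. *)
have minN : 2 * Num.min n.1 n.2 <= 4 * (n.1 * n.2 / (n.1 + n.2)).
  rewrite mulrA ler_pdivlMr ?addr_gt0//.
  by case: (leP n.1 n.2) => n12; nra.
apply: (le_trans (worst_regret_threshold_le n1 n2 bE)).
apply: (@le_trans _ _ (c%:E * (c0 / Num.sqrt (Num.min n.1 n.2))%:E)%E); last first.
  by apply: lee_wpmul2l; rewrite ?lee_fin ?(ltW c_gt0)//.
rewrite -EFinM lee_fin -/r mulrA.
set mm := Num.min n.1 n.2 in minN nmin0 *.
have m0 : 0 < Num.sqrt mm by rewrite sqrtr_gt0.
rewrite ler_pdivrMr// mulrAC ler_pdivlMr//.
apply: (@le_trans _ _ (2 * r)).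
  rewrite -ler_sqr ?nnegrE ?mulr_ge0 ?sqrtr_ge0// !exprMn.
  rewrite /r !sqr_sqrtr ?(ltW nmin0) ?(ltW N0)//; lra.
by rewrite ler_pM2r// ltW// -ltr_pdivrMr.
Qed.

End minimax.

(** * Exponential lower bound on the ratio, by a two-point argument *)

Section main.
Context {R : realType}.
Implicit Types (n theta : R * R) (A : algorithm R).

(** Covers [y = 0] as well: then [x] is positive and the quotient is [+oo]. *)
Lemma lee_pdiv (x y : \bar R) (p q : R) : 0 < p -> 0 < q ->
  ((p * q)%:E <= x -> 0 <= y -> y <= q%:E -> p%:E <= x / y)%E.
Proof.
move=> p0 q0 px; case: y => [s|//|//]; rewrite !lee_fin => s0 sq.
rewrite inver; case: eqVneq => [_|sn0].
  by rewrite gt0_muley ?leey// (lt_le_trans _ px)// lte_fin mulr_gt0.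
have {sn0}s_gt0 : 0 < s by rewrite lt_neqAle eq_sym sn0.
apply: (@le_trans _ _ ((p * q)%:E * (s^-1)%:E)%E).
  by rewrite -EFinM lee_fin ler_pdivlMr// ler_wpM2l// ltW.
by rewrite lee_wpmul2r// lee_fin invr_ge0.
Qed.

Lemma regret_ratio_ge n (c p : R) A theta (b : bool) :
  let r := Num.sqrt (n.1 * n.2 / (n.1 + n.2)) in
  0 < n.1 -> 0 < n.2 -> 0 < p ->
  (forall b, `|b| = (2 * r)^-1 -> minimax_optimal n c (threshold b)) ->
  instances theta ->
  arm_mean theta (~~ b) - arm_mean theta b = 1 / 2 ->
  ((p * expR (- (r / 4) - r ^+ 2 / 8))%:E <= arm_prob n A theta b)%E ->
  (p%:E <= worst_ratio n c A)%E.
Proof.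
move=> r n1 n2 p0 opt th01 gap pA.
have N0 : 0 < n.1 * n.2 / (n.1 + n.2) by rewrite divr_gt0 ?mulr_gt0 ?addr_gt0.
have r0 : 0 < r by rewrite sqrtr_gt0.
have Nr : n.1 * n.2 / (n.1 + n.2) = r ^+ 2 by rewrite sqr_sqrtr// ltW.
have [/andP[t10 _] /andP[t20 _]] := th01.
apply: le_trans (ereal_sup_ubound _); last by exists theta.
have gap_le : arm_mean theta b <= arm_mean theta (~~ b) by lra.
(* The regret bound for the favourably shifted threshold: [|D| = 1 / 2] and
   [D * b0 = - 1 / (4 * r)], with [N = r ^+ 2]. *)
set q := (1 / 2 * expR (- (r / 4) - r ^+ 2 / 8)).
have q0 : 0 < q by rewrite mulr_gt0 ?expR_gt0.
apply: (lee_pdiv (q := q)) => //.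
- rewrite (regretE n A t10 t20 gap_le) gap.
  by rewrite /q mulrCA (EFinM (1 / 2)); apply: lee_wpmul2l.
- by apply: le_ereal_inf_tmp => _ [A' _ <-]; exact: regret_ge0.
- pose D := theta.1 - theta.2.
  have DE : `|D| = 1 / 2.
    rewrite /D; case: b gap {pA gap_le} => /= gap.
    + by rewrite -gap distrC ger0_norm//; lra.
    + by rewrite -gap ger0_norm//; lra.
  (* The sign opposite to [D] moves the threshold so that the better arm is played more often. *)
  pose b0 := - Num.sg D * (2 * r)^-1.
  have b0E : `|b0| = (2 * r)^-1.
    rewrite normrM normrN normr_sg (_ : D != 0) ?mul1r; last first.
      by rewrite -normr_eq0 DE; lra.
    by rewrite ger0_norm// invr_ge0 mulr_ge0// ltW.
  apply: ge_ereal_inf; exists (regret n (threshold b0) theta).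
    by exists (threshold b0) => //; exact: opt.
  apply: (le_trans (regret_threshold_le b0 n1 n2 th01)).
  rewrite -/D DE lee_fin /q ler_wpM2l// ler_expR Nr.
  have -> : D * b0 = - (1 / 2) * (2 * r)^-1.
    by rewrite /b0 mulrA mulrN (mulrC D) -normrEsg DE.
  have -> : D ^+ 2 = 1 / 4.
    by rewrite -real_normK ?num_real// DE; lra.
  by rewrite le_eqVlt; apply/orP; left; apply/eqP; field; rewrite gt_eqF.
Qed.

Lemma worst_ratio_ge n (c : R) A :
  let r := Num.sqrt (n.1 * n.2 / (n.1 + n.2)) in
  0 < n.1 -> 0 < n.2 ->
  (forall b, `|b| = (2 * r)^-1 -> minimax_optimal n c (threshold b)) ->
  ((window_mass (8^-1) / 2 * expR (r / 8))%:E <= worst_ratio n c A)%E.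
Proof.
move=> r n1 n2 opt.
have N0 : 0 < n.1 * n.2 / (n.1 + n.2) by rewrite divr_gt0 ?mulr_gt0 ?addr_gt0.
have r0 : 0 < r by rewrite sqrtr_gt0.
have Nr : n.1 * n.2 / (n.1 + n.2) = r ^+ 2 by rewrite sqr_sqrtr// ltW.
have n12 : 0 < n.1 + n.2 by exact: addr_gt0.
set k := window_mass _.
have k0 : 0 < k by apply: window_mass_gt0; rewrite invr_gt0.
pose v := n.2 / (n.1 + n.2).
have v0 : 0 <= v by rewrite divr_ge0 ?ltW.
have v1 : v <= 1 by rewrite ler_pdivrMr// mul1r lerDr ltW.
(* For [s = 1] and [s = - 1] the gap is 1/2 in opposite directions. The weight [v] is chosen so that
   both instances have the count-weighted mean 1/2, hence the same reference law. *)
pose theta s : R * R := (1 / 2 + s * (v / 2), 1 / 2 - s * ((1 - v) / 2)).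
have th01 s : `|s| = 1 -> instances (theta s).
  move=> /eqP; rewrite eqr_norml ler01 andbT => /orP[] /eqP ->;
    split; apply/andP; rewrite /theta/=; split; lra.
have thD s : (theta s).1 - (theta s).2 = s / 2 by rewrite /theta/=; lra.
pose W := window n (1 / 2) 8^-1.
have mW : measurable W by exact: measurable_window.
pose h : R := 1 / 2.
pose J (b : bool) : \bar R :=
  (\int[data_law n (h, h)]_(x in W) A n x [set b])%E.
(* On the window [|x.1 - x.2|] is at most [1 / (4 * r)]; times the gap 1/2 this gives [(8 * r)^-1],
   and multiplying by [r ^+ 2] gives the loss [r / 8] in the exponent. *)
have prob_ge s b : `|s| = 1 ->
    ((expR (- (r / 8) - r ^+ 2 / 8))%:E * J b <= arm_prob n A (theta s) b)%E.
  move=> s1.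
  have := @data_law_ge _ n (theta s) h (- (8 * r)^-1)
    (fun x => A n x [set b]) W n1 n2 _ (measurable_algorithm A n b) _ mW.
  rewrite thD Nr.
  have -> : r ^+ 2 * (- (8 * r)^-1 - (s / 2) ^+ 2 / 2) =
      - (r / 8) - r ^+ 2 / 8.
    rewrite exprMn -[s ^+ 2]real_normK ?num_real// s1.
    by field; rewrite gt_eqF.
  apply => //.
  - by rewrite /theta/h/= /v; field; rewrite gt_eqF.
  - move=> x /(window_diff n1 n2); rewrite invr_gt0 => /(_ (ltr0n _ 8)).
    rewrite -/r => xr; rewrite lerNl -mulNr.
    apply: le_trans (ler_norm _) _.
    rewrite normrM normrN normrM s1 mul1r.
    rewrite (_ : (8 * r)^-1 = `|2^-1| * (2 * 8^-1 / r)).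
      by rewrite ler_wpM2l.
    by rewrite ger0_norm ?invr_ge0//; field; rewrite gt_eqF.
(* The two arm probabilities add up to 1 at every data point, so one of [J true], [J false] is at
   least [k / 2]; the instance for which that arm is wrong is then selected. *)
have JE : (k%:E <= J true + J false)%E.
  have k_le : (k%:E <= data_law n (h, h) W)%E.
    by apply: data_law_window => //; rewrite invr_gt0.
  apply: (le_trans k_le).
  have mA b : measurable_fun W (fun x => A n x [set b]).
    by apply: measurable_funTS; exact: measurable_algorithm.
  rewrite -(ge0_integralD (data_law n (h, h)) mW) //.
  rewrite (eq_integral (cst 1%E)); last first.
    move=> x _; rewrite -measureU//; last first.
      by apply/seteqP; split=> // -[] [].
    rewrite -[RHS](prob_kernel (s := A n) x); congr (A n x _).
    by rewrite setT_bool.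
  by rewrite integral_cst// mul1e.
have p0 : 0 < k / 2 * expR (r / 8) by rewrite mulr_gt0 ?expR_gt0 ?divr_gt0.
have ratio_of_error s b : `|s| = 1 ->
    arm_mean (theta s) (~~ b) - arm_mean (theta s) b = 1 / 2 ->
    ((k / 2)%:E <= J b)%E ->
    ((k / 2 * expR (r / 8))%:E <= worst_ratio n c A)%E.
  move=> s1 gap kJ.
  apply: (regret_ratio_ge n1 n2 p0 opt (th01 s s1) gap).
  apply: le_trans (prob_ge s b s1).
  rewrite -/r -mulrA -expRD (_ : r / 8 + _ = - (r / 8) - r ^+ 2 / 8); last by lra.
  by rewrite mulrC EFinM; apply: lee_wpmul2l.
have [kJ|Jk] := leP (k / 2)%:E (J true).
  apply: (ratio_of_error (- 1) true) => //; first by rewrite normrN1.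
  by rewrite /theta/=; lra.
apply: (ratio_of_error 1 false) => //; first by rewrite normr1.
  by rewrite /theta/=; lra.
rewrite leNgt; apply/negP => Jk'.
have := le_lt_trans JE (lteD Jk Jk').
by rewrite -EFinD -splitr ltxx.
Qed.

End main.

Theorem corollary5 (R : realType) (c0 : R) (c0_gt0 : 0 < c0)
  (minimax_lb : forall n1 n2 : R, 1 <= n1 -> 1 <= n2 ->
    ((c0 / Num.sqrt (Num.min n1 n2))%:E <= minimax_regret (n1, n2))%E)
  (pi1 : R) (pi1_gt0 : 0 < pi1) (pi1_lt1 : pi1 < 1)
  (c : R) (c_gt : 2 / c0 < c) (A : algorithm R) :
  limf_esup (fun n : R => worst_ratio (pi1 * n, (1 - pi1) * n) c A) (+oo_R)
  = +oo%E.
Proof.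
set F := fun n : R => _.
have pi2_gt0 : 0 < 1 - pi1 by rewrite subr_gt0.
pose k : R := window_mass 8^-1.
have k0 : 0 < k by apply: window_mass_gt0; rewrite invr_gt0.
(* The first two bounds on [x] make both counts at least 1, as [minimax_lb] demands. Since
   [r ^+ 2 = pi1 * (1 - pi1) * x], the last one gives [16 * M / k <= r], so that [k / 2 * (r / 8)],
   and a fortiori [k / 2 * expR (r / 8)], is at least [M]. *)
have F_ge (M x : R) : 0 <= M -> pi1^-1 <= x -> (1 - pi1)^-1 <= x ->
    (16 * M / k) ^+ 2 / (pi1 * (1 - pi1)) <= x -> (M%:E <= F x)%E.
  move=> M0 x1 x2 xM.
  have n1 : 1 <= pi1 * x by rewrite -ler_pdivrMl// mulr1.
  have n2 : 1 <= (1 - pi1) * x by rewrite -ler_pdivrMl// mulr1.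
  have x0 : 0 < x by rewrite (lt_le_trans _ x1)// invr_gt0.
  have n1_gt0 : 0 < pi1 * x by rewrite mulr_gt0.
  have n2_gt0 : 0 < (1 - pi1) * x by rewrite mulr_gt0.
  apply: le_trans (worst_ratio_ge (n := (pi1 * x, (1 - pi1) * x)) A
    n1_gt0 n2_gt0 _); last first.
    move=> b bE.
    exact: (@threshold_minimax_optimal _ (pi1 * x, (1 - pi1) * x) c0 c b
      n1_gt0 n2_gt0 c0_gt0 c_gt (minimax_lb _ _ n1 n2) bE).
  set r := Num.sqrt _.
  have rM : 16 * M / k <= r.
    have rE : r = Num.sqrt (x * (pi1 * (1 - pi1))).
      rewrite /r/= -mulrDl subrKC mul1r; congr Num.sqrt; field.
      by rewrite gt_eqF.
    rewrite rE.
    have -> : 16 * M / k = Num.sqrt ((16 * M / k) ^+ 2).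
      by rewrite sqrtr_sqr ger0_norm// divr_ge0 ?mulr_ge0// ltW.
    by rewrite ler_wsqrtr// -ler_pdivrMr ?mulr_gt0.
  rewrite lee_fin -/k.
  have M_le : M <= k / 2 * (r / 8).
    by move: rM; rewrite ler_pdivrMr//; lra.
  apply: (le_trans M_le); apply: ler_wpM2l; first by rewrite divr_ge0 ?(ltW k0).
  by rewrite (le_trans _ (expR_ge1Dx _))// lerDr.
(* The limit superior is an infimum over neighbourhoods [V] of [+oo] of suprema over [V]. Each [V]
   contains a ray beyond [x0], so one point of that ray with [F] at least [M] suffices for every
   [M]. *)
apply/ereal_inf_pinfty => _ [V [x0 [_ x0V]] <-] /=.
apply/eqyP => M M0.
pose x := Num.max (x0 + 1) (Num.max pi1^-1 (Num.max (1 - pi1)^-1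
  ((16 * M / k) ^+ 2 / (pi1 * (1 - pi1))))).
apply: le_trans (F_ge M x (ltW M0) _ _ _) _.
- by rewrite /x !le_max lexx !orbT.
- by rewrite /x !le_max lexx !orbT.
- by rewrite /x !le_max lexx !orbT.
- apply: ereal_sup_ubound; exists x => //; apply: x0V.
  by rewrite /x lt_max ltrDl ltr01.
Qed.
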